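(* Let $\{F_d\}_{d\in\mathbb{N}}$ be a filtration of $R$ or of $L$ (with finite-dimensional components). Let $\mu=g\mu_+$ be a signed measure, where $\mu_+$ is a non-negative measure on $\Omega$ with finite moments and $g\in F_\delta$ is a polynomial for some $\delta\in\mathbb{N}$. Then $$\mathrm{I}(\operatorname{supp}\mu)\cap F_d=\ker H_{d+\delta,d}$$ for every $d\in\mathbb{N}$, with $H_{d+\delta,d}:=\bigl(\langle w,v\rangle_\sigma\bigr)_{w\in B_{d+\delta},\,v\in B_d}$, where $\sigma\colon L\to\mathbb{K}$ denotes the moment functional of $\mu$ and $B_d,B_{d+\delta}$ denote finite bases of $F_d,F_{d+\delta}$, respectively.
   Context: The statement concerns each of the following two settings ($n\in\mathbb{N}$). Affine case: $\Omega=\mathbb{R}^n$, $\mathbb{K}=\mathbb{R}$, $L=R=\mathbb{R}[x_1,\dots,x_n]$, and the involution $\circ$ on $\mathbb{K}$ and $L$ is the identity. Trigonometric case: $\Omega=\mathbb{T}^n=\{z\in\mathbb{C}^n:|z_1|=\dots=|z_n|=1\}$, $\mathbb{K}=\mathbb{C}$, $R=\mathbb{C}[x_1,\dots,x_n]$, $L=\mathbb{C}[x_1^{\pm1},\dots,x_n^{\pm1}]$, and the involution on $L$ is $\bigl(\sum_\alpha p_\alpha x^\alpha\bigr)^{\circ}=\sum_\alpha\overline{p_\alpha}\,x^{-\alpha}$. A signed measure on $\Omega$ is a $\mathbb{K}$-valued measure (real signed in the affine case, complex in the trigonometric case), viewed via the Riesz representation theorem as an element of the continuous dual of the space of compactly-supported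 continuous functions $\Omega\to\mathbb{K}$; $g\mu_+$ is the measure with density $g$ with respect to $\mu_+$. Non-negative measures are Borel measures. The support $\operatorname{supp}\mu$ is the set of $\xi\in\Omega$ such that $\mu|_U\ne0$ for every open neighborhood $U\subseteq\Omega$ of $\xi$. For $X\subseteq\Omega$, $\mathrm{I}(X)=\{p\in L:p(\xi)=0\ \forall\xi\in X\}$. The moment functional of $\mu$ is $\sigma(p)=\int_\Omega p\,\mathrm{d}\mu$, and $\langle q,p\rangle_\sigma:=\sigma(q^{\circ}p)$ for $q,p\in L$. A filtration of a $\mathbb{K}$-algebra $A$ is a family of $\mathbb{K}$-subspaces $\{F_d\}_{d\in\mathbb{N}}$ with $F_d\subseteq F_e$ for $d\le e$, $A=\bigcup_dF_d$, $1\in F_0$, $F_dF_e\subseteq F_{d+e}$. The kernel of $H_{d+\delta,d}$ is regarded as a subspace of $F_d$ via the basis $B_d$, i.e. $\ker H_{d+\delta,d}=\{p\in F_d:\langle q,p\rangle_\sigma=0\ \forall q\in F_{d+\delta}\}$. *)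

(* Defs.v *)
From HB Require Import structures.
From mathcomp Require Import all_boot all_order all_algebra finmap.
From mathcomp Require Import all_classical all_reals all_analysis.
From mathcomp Require Import complex.
(* The notations of these two files clash with those of mathcomp-analysis. *)
From mathcomp Require Import(canonicals,coercions) monalg mpoly.

Set Implicit Arguments.
Unset Strict Implicit.
Unset Printing Implicit Defensive.

Import Order.TTheory GRing.Theory Num.Theory.
Import numFieldNormedType.Exports.

Local Open Scope classical_set_scope.
Local Open Scope ring_scope.

Section Filtrations.
Context (K : fieldType) (L : lalgType K).

Definition subspace_of (V : set L) :=
  V 0 /\ forall (a : K) (u v : L), V u -> V v -> V (a *: u + v).

(* Filtration of a subalgebra A of the ambient algebra L, the components being
   given as subsets of L. *)
Record filtration (A : set L) (F : nat -> set L) : Prop := Filtration {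
  filtration_subspace : forall d, subspace_of (F d) ;
  filtration_mono : forall d e, (d <= e)%N -> F d `<=` F e ;
  filtration_union : A = \bigcup_d F d ;
  filtration_one : F 0%N 1 ;
  filtration_mul : forall d e p q, F d p -> F e q -> F (d + e)%N (p * q)
}.

Definition lincomb m (B : 'I_m -> L) (c : 'cV[K]_m) : L :=
  \sum_(j < m) c j 0 *: B j.

Definition basis_of_set (V : set L) m (B : 'I_m -> L) :=
  (forall c, lincomb B c = 0 -> c = 0) /\ V = range (lincomb B).

Definition findim (V : set L) := exists m (B : 'I_m -> L), basis_of_set V B.

Definition sesqui (star : L -> L) (sigma : L -> K) (q p : L) : K :=
  sigma (star q * p).

Definition moment_matrix (star : L -> L) (sigma : L -> K)
    m' m (W : 'I_m' -> L) (V : 'I_m -> L) : 'M[K]_(m', m) :=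
  \matrix_(i, j) sesqui star sigma (W i) (V j).

(* The kernel {c | H c = 0} of a matrix whose columns are indexed by V,
   transported to L through the coordinates with respect to V. *)
Definition mxker m' m (V : 'I_m -> L) (H : 'M[K]_(m', m)) : set L :=
  [set lincomb V c | c in [set c : 'cV[K]_m | H *m c = 0]].

Definition vanishing (X : Type) (ev : L -> X -> K) (Y : set X) : set L :=
  [set p | forall x, Y x -> ev p x = 0].

End Filtrations.

Section LaurentRing.
Context (n : nat) (K : comNzRingType).

(* Laurent polynomials in n variables: finitely supported functions from the
   exponents in Z^n to K. *)
Definition laurent := monalg.malg 'rV[int]_n K.

HB.instance Definition _ := GRing.Lmodule.on laurent.

Implicit Types (p q : laurent) (a b : 'rV[int]_n).

Local Notation mon c a := (@monalg.mkmalgU _ K a c : laurent).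
Local Notation coef p a := (@monalg.mcoeff _ K a p).
Local Notation supp p := (@monalg.msupp _ K p).

Definition laurent_one : laurent := mon 1 0.

Definition laurent_mul p q : laurent :=
  \sum_(a <- supp p) \sum_(b <- supp q) mon (coef p a * coef q b) (a + b).

Lemma laurent_mulw (d e : {fset 'rV[int]_n}) p q :
    (supp p `<=` d)%fset -> (supp q `<=` e)%fset ->
  laurent_mul p q = \sum_(a <- d) \sum_(b <- e) mon (coef p a * coef q b) (a + b).
Proof.
move=> pd qe; rewrite /laurent_mul (big_fset_incl _ pd) /=.
  apply/eq_bigr=> a _; apply/big_fset_incl => // b _ /monalg.mcoeff_outdom ->.
  by rewrite mulr0 monalg.monalgU0.
move=> a _ /monalg.mcoeff_outdom pa.
by rewrite big1 // => b _; rewrite pa mul0r monalg.monalgU0.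
Qed.

Lemma laurent_mulC : commutative laurent_mul.
Proof.
move=> p q; rewrite /laurent_mul exchange_big /=.
by apply/eq_bigr=> b _; apply/eq_bigr=> a _; rewrite mulrC addrC.
Qed.

Lemma laurent_mulDl : left_distributive laurent_mul +%R.
Proof.
move=> p q r; pose d := (supp p `|` supp q)%fset.
have pq : (supp (p + q) `<=` d)%fset by exact: monalg.msuppD_le.
rewrite (laurent_mulw (fsubsetUl _ _ : (supp p `<=` d)%fset) (fsubset_refl _)).
rewrite (laurent_mulw (fsubsetUr _ _ : (supp q `<=` d)%fset) (fsubset_refl _)).
rewrite (laurent_mulw pq (fsubset_refl _)) -big_split /=.
apply/eq_bigr=> a _; rewrite -big_split /=; apply/eq_bigr=> b _.
by rewrite monalg.mcoeffD mulrDl monalg.monalgUD.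
Qed.

Lemma laurent_mul0l : left_zero 0 laurent_mul.
Proof. by move=> p; rewrite /laurent_mul monalg.msupp0 big_seq_fset0. Qed.

Lemma laurent_mulDr : right_distributive laurent_mul +%R.
Proof. by move=> r p q; rewrite ![laurent_mul r _]laurent_mulC laurent_mulDl. Qed.

Lemma laurent_mul0r : right_zero 0 laurent_mul.
Proof. by move=> p; rewrite laurent_mulC laurent_mul0l. Qed.

Lemma laurent_mulUU (c c' : K) a b :
  laurent_mul (mon c a) (mon c' b) = mon (c * c') (a + b).
Proof.
rewrite (laurent_mulw monalg.msuppU_le monalg.msuppU_le) !big_seq_fset1.
by rewrite !monalg.mcoeffUU.
Qed.

Lemma laurent_suml I (r : seq I) (f : I -> laurent) q :
  laurent_mul (\sum_(i <- r) f i) q = \sum_(i <- r) laurent_mul (f i) q.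
Proof.
by apply: (big_morph (laurent_mul^~ q)) => [x y|];
  rewrite ?laurent_mulDl ?laurent_mul0l.
Qed.

Lemma laurent_sumr I (r : seq I) (f : I -> laurent) q :
  laurent_mul q (\sum_(i <- r) f i) = \sum_(i <- r) laurent_mul q (f i).
Proof.
by rewrite laurent_mulC laurent_suml; apply: eq_bigr => i _; rewrite laurent_mulC.
Qed.

Lemma laurentE p : p = \sum_(a <- supp p) mon (coef p a) a.
Proof. exact: monalg.monalgE. Qed.

Lemma laurent_mulA : associative laurent_mul.
Proof.
move=> p q r; rewrite (laurentE p) !laurent_suml; apply: eq_bigr => a _.
rewrite (laurentE q) laurent_suml !laurent_sumr laurent_suml.
apply: eq_bigr => b _.
rewrite (laurentE r) !laurent_sumr; apply: eq_bigr => c _.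
by rewrite !laurent_mulUU mulrA addrA.
Qed.

Lemma laurent_mul1l : left_id laurent_one laurent_mul.
Proof.
move=> p; rewrite [in LHS](laurentE p) laurent_sumr [RHS]laurentE.
by apply: eq_bigr => a _; rewrite laurent_mulUU mul1r add0r.
Qed.

Lemma laurent_one_neq0 : laurent_one != 0.
Proof.
apply/eqP => /(congr1 (fun p : laurent => coef p 0)).
by rewrite monalg.mcoeffUU monalg.mcoeff0 => /eqP; rewrite oner_eq0.
Qed.

HB.instance Definition _ := GRing.Zmodule_isComNzRing.Build laurent
  laurent_mulA laurent_mulC laurent_mul1l laurent_mulDl laurent_one_neq0.

Lemma laurent_scaleAl (c : K) p q : c *: (p * q) = (c *: p) * q.
Proof.
have scaleE (r : laurent) : c *: r = (mon c 0 : laurent) * r.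
  rewrite [in RHS](laurentE r) mulr_sumr.
  by apply: eq_bigr => a _; rewrite /GRing.mul /= laurent_mulUU add0r.
by rewrite !scaleE mulrA.
Qed.

HB.instance Definition _ :=
  GRing.Lmodule_isLalgebra.Build K laurent laurent_scaleAl.

HB.instance Definition _ := GRing.Lalgebra_isComAlgebra.Build K laurent.

(* K[x_1, ..., x_n] as a subset of the Laurent polynomials *)
Definition is_poly : set laurent :=
  [set p | forall a, coef p a != 0 -> forall i, 0 <= a 0 i].

End LaurentRing.

Section LaurentComplex.
Context (C : numClosedFieldType) (n : nat).

(* the involution conjugating coefficients and mapping x^a to x^(-a) *)
Definition laurent_star (p : laurent n C) : laurent n C :=
  \sum_(a <- monalg.msupp p) monalg.mkmalgU (- a) (monalg.mcoeff a p)^*.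

Definition laurent_eval (p : laurent n C) (z : 'rV[C]_n) : C :=
  \sum_(a <- monalg.msupp p) monalg.mcoeff a p * \prod_(i < n) z 0 i ^ a 0 i.

End LaurentComplex.

Notation borel T := (g_sigma_algebraType (@open T)).

Section Support.
Context (T : ptopologicalType) (V : nmodType).

Definition nonzero_on (mu : set (borel T) -> V) (U : set T) :=
  exists2 A : set (borel T), measurable A & mu (A `&` U) <> 0.

Definition measure_support (mu : set (borel T) -> V) : set T :=
  [set x | forall U : set T, open U -> U x -> nonzero_on mu U].

End Support.

Section SignedMeasures.
Context d (T : measurableType d) (R : realType).

Definition hahn_pos (nu : {charge set T -> \bar R}) : set T :=
  projT1 (cid (Hahn_decomposition nu)).

Definition hahn_neg (nu : {charge set T -> \bar R}) : set T :=
  projT1 (cid (projT2 (cid (Hahn_decomposition nu)))).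

Definition hahn_posneg (nu : {charge set T -> \bar R}) :
    hahn_decomposition nu (hahn_pos nu) (hahn_neg nu) :=
  projT2 (cid (projT2 (cid (Hahn_decomposition nu)))).

(* The integral with respect to the Jordan decomposition of nu, which does not
   depend on the chosen Hahn decomposition. *)
Definition charge_integral (nu : {charge set T -> \bar R}) (f : T -> R) : R :=
  Rintegral (jordan_pos (hahn_posneg nu)) setT f -
  Rintegral (jordan_neg (hahn_posneg nu)) setT f.

Definition charge_density (nu : {charge set T -> \bar R})
    (mu : {measure set T -> \bar R}) (g : T -> R) :=
  forall A, measurable A -> nu A = (\int[mu]_(x in A) (g x)%:E)%E.

Record complex_measure := ComplexMeasure {
  cmeasure_re : {charge set T -> \bar R} ;
  cmeasure_im : {charge set T -> \bar R}
}.

(* Charges are finite on measurable sets, so fine loses nothing there. *)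
Definition cmeasure_val (nu : complex_measure) (A : set T) : R[i] :=
  (fine (cmeasure_re nu A) +i* fine (cmeasure_im nu A))%C.

Definition cmeasure_integral (nu : complex_measure) (f : T -> R[i]) : R[i] :=
  let Ref x := complex.Re (f x) in let Imf x := complex.Im (f x) in
  ((charge_integral (cmeasure_re nu) Ref - charge_integral (cmeasure_im nu) Imf)
   +i*
   (charge_integral (cmeasure_re nu) Imf + charge_integral (cmeasure_im nu) Ref))%C.

Definition cmeasure_density (nu : complex_measure)
    (mu : {measure set T -> \bar R}) (g : T -> R[i]) :=
  charge_density (cmeasure_re nu) mu (fun x => complex.Re (g x)) /\
  charge_density (cmeasure_im nu) mu (fun x => complex.Im (g x)).

End SignedMeasures.

Section Affine.
Context (R : realType) (n : nat).

Definition affine_eval (p : mpoly.mpoly n R) (x : 'rV[R]_n) : R :=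
  mpoly.meval (fun i => x 0 i) p.

Definition affine_finite_moments
    (mu : {measure set (borel 'rV[R]_n) -> \bar R}) :=
  forall a : 'I_n -> nat,
    mu.-integrable setT (fun x => (\prod_(i < n) x 0 i ^+ a i)%:E).

Definition affine_moment (mu : {charge set (borel 'rV[R]_n) -> \bar R})
    (p : mpoly.mpoly n R) : R :=
  charge_integral mu (affine_eval p).

End Affine.

Section Torus.
Context (C : numClosedFieldType) (n : nat).

Definition torus_set : set 'rV[C]_n := [set z : 'rV[C]_n | forall i, `|z 0 i| = 1].

Definition torus := set_type torus_set.

Lemma torus_set1 : torus_set (const_mx 1).
Proof. by move=> i; rewrite mxE normr1. Qed.

HB.instance Definition _ := Topological.on torus.
HB.instance Definition _ :=
  isPointed.Build torus (SigSub (mem_set torus_set1) : torus).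

Definition torus_eval (p : laurent n C) (z : torus) : C :=
  laurent_eval p (set_val z).

End Torus.

Section Trigonometric.
Context (R : realType) (n : nat).

Local Notation C := (complex R).
Local Notation torus := (torus C n).

Definition torus_finite_moments (mu : {measure set (borel torus) -> \bar R}) :=
  forall a : 'rV[int]_n, let m (z : torus) : C := \prod_(i < n) (set_val z) 0 i ^ a 0 i in
    mu.-integrable setT (fun z => (complex.Re (m z))%:E) /\
    mu.-integrable setT (fun z => (complex.Im (m z))%:E).

Definition torus_moment (mu : complex_measure (borel torus) R)
    (p : laurent n C) : C :=
  cmeasure_integral mu (torus_eval p).

End Trigonometric.

(* Main.v *)
Require Import Defs.
From HB Require Import structures.
From mathcomp Require Import all_boot all_order all_algebra finmap.
From mathcomp Require Import all_classical all_reals all_analysis.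
From mathcomp Require Import measurable_realfun.
From mathcomp Require Import complex.
From mathcomp Require Import ring.
From mathcomp Require Import(canonicals,coercions) monalg mpoly.

Set Implicit Arguments.
Unset Strict Implicit.
Unset Printing Implicit Defensive.

Import Order.TTheory GRing.Theory Num.Theory.
Import numFieldNormedType.Exports.

Local Open Scope classical_set_scope.
Local Open Scope ring_scope.

(** Membership in either side of the identity is equivalent, for [p] in [F d],
to a third condition: [g * p] vanishes [mu_+]-almost everywhere.

Support.  The set where the polynomial [p] does not vanish is open, and [mu]
has density [g], so an open set is [mu]-null exactly when [g] is zero
[mu_+]-almost everywhere on it.  By second countability, an open set that
avoids the support of [mu] is covered by countably many [mu]-null open sets,
hence is itself [mu]-null.  Thus [p] vanishes on the support if and only if
[g = 0] almost everywhere on the set where [p] is nonzero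
([vanishing_measure_support], [charge_null_set]).

Kernel.  As [sigma f] is the integral of [f * g] against [mu_+], the form
[<q, p>] is the integral of [q° * (g * p)], which is zero for every [q] when
[g * p] vanishes almost everywhere.  Conversely, [q = g * p] has degree
[d + delta], which is why the moment matrix has rows up to that degree; for
this [q] the form is the integral of [|g * p| ^ 2], and its vanishing forces
[g * p] to vanish almost everywhere ([null_space_kernel]).

The analytic work lies in the formula for [sigma].  Integration against a
signed measure goes through a Jordan decomposition, and both of its parts have
to be rewritten with respect to [mu_+]; this is done by comparing the density
with a Radon-Nikodym derivative ([ge0_integral_density],
[charge_integral_density]) and, for complex measures, by recombining real and
imaginary parts ([cmeasure_integral_density]).  Finiteness of all moments makes
every polynomial integrable, so that no integral in the argument is
infinite. *)

(** * Kernels of moment matrices *)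

Section MomentMatrixKernel.
Context (K : fieldType) (L : algType K).
Variables (star : L -> L) (phi : {rmorphism K -> K}) (sigma : L -> K).
Hypothesis star_semilinear :
  forall a u v, star (a *: u + v) = phi a *: star u + star v.
Hypothesis sigma_scalar : scalar sigma.

(** Testing against the rows, which are indexed by a spanning family, amounts to
testing against its whole span, because the form is semilinear on the left. *)
Lemma mxker_moment_matrix m' m (W : 'I_m' -> L) (B : 'I_m -> L) :
  mxker B (moment_matrix star sigma W B) =
  [set p | range (lincomb B) p /\
     forall q, range (lincomb W) q -> sigma (star q * p) = 0].
Proof.
have sigma0 : sigma 0 = 0.
  by have := sigma_scalar (-1) 0 0; rewrite scaler0 addr0 mulN1r addNr.
have star0 : star 0 = 0.
  have := star_semilinear (-1) 0 0.
  by rewrite scaler0 addr0 rmorphN1 scaleN1r addNr.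
have momentE c i : (moment_matrix star sigma W B *m c) i 0 =
    sigma (star (W i) * lincomb B c).
  rewrite mxE /lincomb mulr_sumr.
  elim/big_rec2 : _ => [|j y x _ ->]; first by rewrite sigma0.
  by rewrite mxE /Defs.sesqui -scalerAr sigma_scalar mulrC.
apply/seteqP; split=> [p [c /= Hc <-]|p [[c _ <-] Hp]] /=.
  split; first by exists c.
  move=> q [b _ <-]; rewrite /lincomb.
  elim/big_rec : _ => [|i q' _ IH]; first by rewrite star0 mul0r sigma0.
  rewrite star_semilinear mulrDl -scalerAl sigma_scalar IH addr0.
  by rewrite -momentE Hc mxE mulr0.
exists c => //=; apply/colP => i; rewrite momentE mxE; apply: Hp.
(* The coordinate vector [delta_mx i 0] represents [W i] itself. *)
exists (delta_mx i 0) => //; rewrite /lincomb (bigD1 i)//= mxE !eqxx scale1r.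
by rewrite big1 ?addr0// => j ji; rewrite mxE (negbTE ji) scale0r.
Qed.

(** The algebraic core.  Multiplication by [g] raises the filtration degree by at
most [delta], so [g * p] is an admissible test element for any [p] in [F d];
the second assumption on [null] says that this single test is decisive. *)
Lemma null_space_kernel (A : set L) (F : nat -> set L) (null : set L) delta g
    d m m' (B : 'I_m -> L) (W : 'I_m' -> L) :
  filtration A F -> F delta g ->
  (forall p q, null p -> sigma (star q * p) = 0) ->
  (forall p, sigma (star (g * p) * p) = 0 -> null p) ->
  basis_of_set (F d) B -> basis_of_set (F (d + delta)%N) W ->
  null `&` F d = mxker B (moment_matrix star sigma W B).
Proof.
move=> filtF Fg null_ker ker_null [_ FdE] [_ FddE].
rewrite mxker_moment_matrix -FdE -FddE; apply/seteqP; split=> p [].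
  by move=> np Fp; split => // q _; exact: null_ker.
move=> Fp ker_p; split => //; apply/ker_null/ker_p; rewrite addnC.
exact: (filtration_mul filtF Fg Fp).
Qed.

End MomentMatrixKernel.

(** * Second countability *)

(** The balls of radius [1 / (k + 1)] centred at the points [D i] form a basis.
The Archimedean assumption is stated in [K] itself because the radii of balls
live there, also when [K] is a field of complex numbers. *)
Lemma second_countable_dense (K : numFieldType) (T : pseudoMetricType K)
    (I : countType) (D : I -> T) :
  (forall e : K, 0 < e -> exists k, k.+1%:R^-1 < e) ->
  (forall x e, 0 < e -> exists i, ball x e (D i)) ->
  @second_countable T.
Proof.
move=> archK denseD.
(* Interiors are taken as balls are only neighbourhoods of their centres. *)
exists (range (fun ik : I * nat => (ball (D ik.1) ik.2.+1%:R^-1)°)).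
  exact: (sub_countable (card_image_le _ _)).
split; first by move=> _ [ik _ <-]; exact: open_interior.
move=> x U /nbhs_ballP[e /= e0 xeU].
have [k ke] : exists k, k.+1%:R^-1 < e / 2 by apply: archK; rewrite divr_gt0.
have k0 : 0 < k.+1%:R^-1 :> K by [].
have [i xi] : exists i, ball x (k.+1%:R^-1 / 2) (D i).
  by apply: denseD; rewrite divr_gt0.
have k20 : 0 < k.+1%:R^-1 / 2 :> K by rewrite divr_gt0.
exists (ball (D i) k.+1%:R^-1)°; first split; first by exists (i, k).
  apply/nbhs_ballP; exists (k.+1%:R^-1 / 2) => //= y xy.
  by apply: ball_splitr xy; rewrite ?divr_gt0//; exact/ball_sym.
apply: subset_trans xeU => y /interior_subset Diy.
apply: ball_split (le_ball (ltW ke) Diy).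
by apply: le_ball xi; rewrite (le_trans _ (ltW ke))// ler_piMr// invf_le1// ler1n.
Qed.

Lemma second_countable_initial (S : choiceType) (T : topologicalType)
  (f : S -> T) : @second_countable T -> @second_countable (initial_topology f).
Proof.
move=> [B cB [Bo Bb]]; exists [set f @^-1` U | U in B].
  exact: (sub_countable (card_image_le _ _)).
split; first by move=> _ [U /Bo oU <-]; exists U.
move=> x V.
rewrite nbhsE => -[_ [[W oW <-] /= Wx] WV].
have [U [BU Ux] UW] := Bb (f x) W (open_nbhs_nbhs (conj oW Wx)).
exists (f @^-1` U); first by split => //; exists U.
by apply: subset_trans WV => y /UW.
Qed.

Lemma second_countable_rV (K : numFieldType) n (I : countType) (D : I -> K) :
  (forall e : K, 0 < e -> exists k, k.+1%:R^-1 < e) ->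
  (forall x e, 0 < e -> exists i, `|x - D i| < e) ->
  @second_countable 'rV[K]_n.
Proof.
move=> archK denseD.
have := @second_countable_dense K 'rV[K]_n {ffun 'I_n -> I}
  (fun q => \row_i D (q i)) archK; apply=> x e e0.
pose q := [ffun j => sval (cid (denseD (x 0 j) e e0))].
exists q; split => // i j; rewrite ord1 mxE ffunE.
rewrite -ball_normE; exact: (svalP (cid (denseD (x 0 j) e e0))).
Qed.

Lemma archimedean_inv (R : realType) (e : R) : 0 < e ->
  exists k, k.+1%:R^-1 < e.
Proof.
move=> e0; exists (Num.bound e^-1).
rewrite invf_plt ?posrE//.
apply: lt_le_trans (archi_boundP _) _; rewrite ?invr_ge0 ?(ltW e0)//.
by rewrite ler_nat.
Qed.

Lemma ratr_dense (R : realType) (x e : R) : 0 < e ->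
  exists q : rat, `|x - ratr q| < e.
Proof.
move=> e0; have /rat_in_itvoo[q /itvP qx] : x < x + e by rewrite ltrDl.
exists q; rewrite ltr_distlC !qx.
by rewrite (lt_trans _ (_ : x < ratr q)) ?qx// gtrBl.
Qed.

Lemma complex_archimedean_inv (R : realType) (e : R[i]) : 0 < e ->
  exists k, k.+1%:R^-1 < e.
Proof.
case: e => a b; rewrite ltcE /= => /andP[/eqP b0 /archimedean_inv[k ka]].
exists k; rewrite b0 -(rmorph_nat (real_complex R)) -fmorphV.
by rewrite -[X in _ < X]/(a%:C)%C ltcR.
Qed.

Lemma complex_ratr_dense (R : realType) (x e : R[i]) : 0 < e ->
  exists q : rat * rat, `|x - (ratr q.1 +i* ratr q.2)%C| < e.
Proof.
(* A positive complex number is real: [e] is its value. *)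
case: e => e e' e0; have /andP[/eqP /= e'0 epos] : (e' == 0) && (0 < e).
  by move: e0; rewrite ltcE /=.
have e20 : 0 < e / 2 by rewrite divr_gt0.
have [q1] := ratr_dense (complex.Re x) e20.
have [q2] := ratr_dense (complex.Im x) e20.
move=> h2 h1; exists (q1, q2) => /=.
case: x h1 h2 => a b /= h1 h2; rewrite e'0.
have -> : (a +i* b)%C - (ratr q1 +i* ratr q2)%C =
    ((a - ratr q1) +i* 0)%C + (0 +i* (b - ratr q2))%C by simpc.
apply: le_lt_trans (ler_normD _ _) _.
rewrite !normc_def /= expr0n /= addr0 add0r !sqrtr_sqr -rmorphD /=.
by rewrite [X in _ < X]/(e%:C)%C ltcR [ltRHS]splitr ltrD.
Qed.

(** * Continuity of polynomial expressions *)

(** The common shape of evaluation of ordinary and of Laurent polynomials, a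
factor [G i j] being a power of one coordinate. *)
Lemma continuous_sum_prod (K : numFieldType) (T : topologicalType)
    (I : Type) (J : finType) (r : seq I) (c : I -> K) (G : I -> J -> T -> K) x :
  (forall i j, {for x, continuous (G i j)}) ->
  {for x, continuous (fun y => \sum_(i <- r) c i * \prod_j G i j y)}.
Proof.
move=> cG; apply: (@cvg_big _ _ +%R) => [|i _]; first exact: add_continuous.
apply: cvgM; first exact: cvg_cst.
apply: (@cvg_big K _ ( *%R )) => [|j _]; first exact: mul_continuous.
exact: cG.
Qed.

Lemma continuous_exprz (K : numFieldType) (m : int) (x : K) : x != 0 ->
  {for x, continuous (fun y : K => y ^ m)}.
Proof.
have continuousX k : continuous (fun y : K => y ^+ k).
  elim: k => [|k IH] y; first exact: (@cst_continuous K K 1).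
  rewrite (_ : (fun y : K => y ^+ k.+1) = id \* (fun y => y ^+ k)); last first.
    by apply/funext => z; rewrite exprS.
  apply: (@continuousM K K (fun y => y) (fun y => y ^+ k)); last exact: IH.
  exact: cvg_id.
case: m => k x0; first exact: continuousX.
apply: (@continuousV K K (fun y => y ^+ k.+1)); first by rewrite expf_neq0.
exact: continuousX.
Qed.

(** * Densities and signed measures *)

Section Density.
Context d (T : measurableType d) (R : realType).
Variables (nu : {finite_measure set T -> \bar R}).
Variables (mu : {measure set T -> \bar R}) (h : T -> R).
Hypothesis mufin : (mu setT < +oo)%E.
Hypothesis mh : measurable_fun setT h.
Hypothesis nuE : forall A, measurable A -> nu A = (\int[mu]_(x in A) (h x)%:E)%E.
Local Open Scope ereal_scope.

Let mhE : measurable_fun setT (EFin \o h : T -> \bar R).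
Proof. exact/measurable_EFinP. Qed.

(** The density [h] need not be nonnegative everywhere, only almost everywhere, so
it is first replaced by a Radon-Nikodym derivative of [nu], for which the change
of variables is known and which agrees with [h] almost everywhere. *)
Lemma ge0_integral_density (f : T -> \bar R) :
  measurable_fun setT f -> (forall x, 0 <= f x) ->
  \int[nu]_x f x = \int[mu]_x (f x * (h x)%:E).
Proof.
move=> mf f0.
(* [mu] is repackaged as a finite measure by restricting it to the whole space. *)
have [fmu muE] : exists fmu : {finite_measure set T -> \bar R}, mu = fmu.
  exists (mfrestr measurableT mufin).
  by apply: eq_measure; apply/funext => A; rewrite /= /mfrestr/= /mrestr setIT.
have fnuE : forall A, measurable A -> nu A = \int[mu]_(x in A) (h x)%:E by [].
rewrite muE in fnuE *.
have numu : nu `<< fmu.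
  apply/null_content_dominatesP => A mA muA0; rewrite fnuE//.
  by apply: null_set_integral => //; exact: measurable_funTS.
rewrite -(Radon_Nikodym_SigmaFinite.change_of_variables numu)//.
have mRN : measurable_fun setT (Radon_Nikodym_SigmaFinite.f nu fmu).
  exact: measurable_int (Radon_Nikodym_SigmaFinite.f_integrable numu).
apply: ae_eq_integral => //; [exact: emeasurable_funM..|].
apply: ae_eqe_mul2l; apply: integral_ae_eq => //.
  exact: Radon_Nikodym_SigmaFinite.f_integrable.
by move=> E _ mE; rewrite -Radon_Nikodym_SigmaFinite.f_integral// fnuE.
Qed.

(** Only [f \* h] is assumed [mu]-integrable: it dominates [f^\+ * h] and
[f^\- * h], hence the positive and negative parts of [f] can be treated
separately. *)
Lemma integral_density (f : T -> R) :
  measurable_fun setT f -> mu.-integrable setT (EFin \o (f \* h)%R) ->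
  \int[nu]_x (f x)%:E = \int[mu]_x (f x * h x)%:E.
Proof.
move=> mf ifh.
have mfE : measurable_fun setT (EFin \o f : T -> \bar R).
  exact/measurable_EFinP.
rewrite [LHS]integralE !ge0_integral_density//;
  [|exact: measurable_funeneg|exact: measurable_funepos].
have absfE x : `|(f x)%:E| = (EFin \o f)^\+ x + (EFin \o f)^\- x.
  exact: (congr1 (@^~ x) (fune_abse (EFin \o f))).
have le_fh (g : T -> \bar R) : measurable_fun setT g ->
    (forall x, `|g x| <= `|(f x)%:E|) ->
    mu.-integrable setT (fun x => g x * (h x)%:E).
  move=> mg gf; apply: le_integrable ifh => //; first exact: emeasurable_funM.
  by move=> x _; rewrite abseM /= normrM EFinM lee_pmul.
rewrite -integralB//.
- apply: eq_integral => x _; rewrite -muleBl ?add_def_funeposneg// EFinM.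
  by congr (_ * _); rewrite [RHS](congr1 (@^~ x) (funeposneg (EFin \o f))).
- apply: le_fh; first exact: measurable_funepos.
  by move=> x; rewrite absfE gee0_abs// leeDl.
- apply: le_fh; first exact: measurable_funeneg.
  by move=> x; rewrite absfE gee0_abs// leeDr.
Qed.

End Density.

Section ChargeDensity.
Context d (T : measurableType d) (R : realType).
Variables (nu : {charge set T -> \bar R}) (mu : {measure set T -> \bar R}).
Variable h : T -> R.
Hypothesis mufin : (mu setT < +oo)%E.
Hypothesis ih : mu.-integrable setT (EFin \o h).
Hypothesis nuE : charge_density nu mu h.

Let mh : measurable_fun setT h.
Proof. exact/measurable_EFinP/(measurable_int _ ih). Qed.

(** On a Hahn decomposition [P], [N] the two Jordan parts have the densities
[h * \1_P] and [- h * \1_N]; as [\1_P + \1_N = 1], the difference of their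
integrals is the integral of [f * h]. *)
Lemma charge_integral_density (f : T -> R) :
  measurable_fun setT f -> mu.-integrable setT (EFin \o (f \* h)) ->
  charge_integral nu f = Rintegral mu setT (f \* h).
Proof.
move=> mf ifh.
rewrite /charge_integral; set PN := hahn_posneg nu.
have [[mP _] [mN _] PNT PN0] := PN.
set P := hahn_pos nu in mP PNT PN0 *; set N := hahn_neg nu in mN PNT PN0 *.
have iD (D : set T) (k : T -> R) : measurable D ->
    mu.-integrable setT (EFin \o k) ->
    mu.-integrable setT (EFin \o (k \* \1_D)).
  move=> mD ik; apply: (le_integrable _ _ _ ik) => //.
    by apply/measurable_EFinP/measurable_funM => //;
      exact/measurable_EFinP/(measurable_int _ ik).
  move=> x _ /=; rewrite lee_fin [leLHS]normrM ler_piMr// indicE.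
  by case: (x \in D); rewrite /= ?normr1 ?normr0.
have mhD (D : set T) (mD : measurable D) : measurable_fun setT (h \* \1_D).
  exact: measurable_funM.
have ihD (D : set T) (mD : measurable D) :
    mu.-integrable setT (EFin \o (f \* (h \* \1_D))).
  rewrite (_ : f \* _ = (f \* h) \* \1_D); first exact: iD.
  by apply/funext => x /=; rewrite mulrA.
have nuI (D : set T) (mD : measurable D) A : measurable A ->
    nu (A `&` D) = (\int[mu]_(x in A) ((h \* \1_D) x)%:E)%E.
  move=> mA; rewrite nuE; last exact: measurableI.
  by rewrite integral_mkcondr epatch_indic.
have posE : (\int[jordan_pos PN]_x (f x)%:E =
    \int[mu]_x (f x * (h \* \1_P) x)%:E)%E.
  apply: integral_density => //; first exact: mhD.
    move=> A mA; rewrite -nuI//.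
    by rewrite [LHS]jordan_posE cjordan_posE /crestr0 mem_set.
  exact: ihD.
have negE : (\int[jordan_neg PN]_x (f x)%:E =
    \int[mu]_x (f x * - (h \* \1_N) x)%:E)%E.
  apply: (@integral_density _ _ _ _ mu (-%R \o (h \* \1_N))) => //.
  - exact: measurableT_comp (mhD N mN).
  - move=> A mA; rewrite [LHS]jordan_negE cjordan_negE /crestr0 mem_set// /crestr.
    rewrite nuI// -integralN//; apply: integrable_add_def => //.
    by apply: integrableS (iD _ _ mN ih).
  - rewrite (_ : _ \o _ = -%E \o (EFin \o (f \* (h \* \1_N)))).
      exact/integrableN/ihD.
    by apply/funext => x /=; rewrite mulrN.
have PN1 x : \1_P x + \1_N x = 1 :> R.
  rewrite !indicE; have := in_setI x P N; have := in_setU x P N.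
  rewrite PNT PN0 in_setT in_set0.
  by do 2 case: (_ \in _); rewrite ?addr0 ?add0r.
rewrite /Rintegral posE negE -/(Rintegral _ _ _) -/(Rintegral _ _ _).
rewrite -RintegralB//.
- apply: eq_Rintegral => x _ /=.
  by rewrite mulrN opprK -mulrDr -mulrDr PN1 mulr1.
- exact: ihD.
- rewrite (_ : _ \o _ = -%E \o (EFin \o (f \* (h \* \1_N)))).
    exact/integrableN/ihD.
  by apply/funext => x /=; rewrite mulrN.
Qed.

(** A function is almost everywhere zero on [U] as soon as all its integrals over
measurable subsets of [U] are zero. *)
Lemma charge_null_set (U : set T) : measurable U ->
  (forall A, measurable A -> nu (A `&` U) = 0) <->
  mu.-negligible (U `&` [set x | h x != 0]).
Proof.
move=> mU; split => [nuU|negU].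
  have : ae_eq mu U (EFin \o h) (cst 0)%E.
    apply: integral_ae_eq => //; first exact: integrableS ih.
    move=> E EU mE; rewrite integral0 -nuE//.
    by rewrite -(setIidl EU) nuU.
  apply: negligibleS => x [Ux /= /eqP hx0]/=.
  by move=> /(_ Ux) [].
move=> A mA; rewrite nuE; last exact: measurableI.
rewrite (ae_eq_integral (cst 0%E)) ?integral0//.
- exact: measurableI.
- by apply: measurable_funTS; exact/measurable_EFinP.
- apply: negligibleS negU => x /= /not_implyP[[Ax Ux] hx0]; split => //=.
  by apply/eqP => hx; apply: hx0; rewrite hx.
Qed.

End ChargeDensity.

(** * Supports *)

Section Support.
Context (R : realType) (T : ptopologicalType) (V : nmodType).
Variables (nu : set (borel T) -> V) (mu : {measure set (borel T) -> \bar R}).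
Variable N : set T.
Hypothesis sT : @second_countable T.
Hypothesis nuN : forall U : set T, open U ->
  ~ nonzero_on nu U <-> mu.-negligible (U `&` N).

(** [N] stands for the set where the density of [nu] is nonzero.  The points of [W]
outside the support have null neighbourhoods, not countably many a priori; a
countable basis allows only basic open sets to be used. *)
Lemma open_setI_measure_support (W : set T) : open W ->
  W `&` measure_support nu = set0 <-> mu.-negligible (W `&` N).
Proof.
move=> oW; split=> [Wsupp|negWN]; last first.
  apply/seteqP; split=> // x [Wx /(_ W oW Wx)].
  by have [_] := nuN oW; move=> /(_ negWN).
have [B cB [Bo Bb]] := sT.
have /pcard_surjP[b Bsub] := cB.
(* The basic sets on which [nu] is not null are discarded. *)
pose F k := [set x | mu.-negligible (b k `&` N) /\ (b k `&` N) x].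
apply: (@negligibleS _ _ _ mu (\bigcup_k F k)); last first.
  apply: negligible_bigcup => k.
  have [negk|nnegk] := pselect (mu.-negligible (b k `&` N)).
    by apply: negligibleS negk => x [].
  by apply: negligibleS (negligible_set0 mu) => x [].
move=> x [Wx Nx].
have : ~ measure_support nu x.
  by move=> sx; have : (W `&` measure_support nu) x by []; rewrite Wsupp.
move=> /existsNP[U /not_implyP[oU /not_implyP[Ux nU]]].
have [U' [BU' U'x] U'U] := Bb x U (open_nbhs_nbhs (conj oU Ux)).
have [k _ bk] := Bsub _ BU'.
exists k => //; rewrite /F/= bk; split => //.
by apply: negligibleS ((nuN oU).1 nU); exact: setSI.
Qed.

End Support.

Lemma vanishing_measure_support (R : realType) (T : ptopologicalType)
    (V : nmodType) (nu : set (borel T) -> V)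
    (mu : {measure set (borel T) -> \bar R}) (N : set T)
    (K : numFieldType) (f : T -> K) :
  @second_countable T ->
  (forall U : set T, open U ->
    ~ nonzero_on nu U <-> mu.-negligible (U `&` N)) ->
  continuous f ->
  (forall x, measure_support nu x -> f x = 0) <->
  mu.-negligible ([set x | f x != 0] `&` N).
Proof.
move=> sT nuN cf.
have of0 : open [set x | f x != 0].
  apply: (@open_comp _ _ f [set y | y != 0]) => [x _|]; first exact: cf.
  rewrite openE => /= y y0.
  apply/nbhs_ballP; exists `|y| => /=; first by rewrite normr_gt0.
  move=> z; rewrite -ball_normE /= => yz; apply/eqP => z0.
  by move: yz; rewrite z0 subr0 ltxx.
rewrite -(open_setI_measure_support sT nuN of0); split=> [f0|f0 x sx].
  by apply/seteqP; split=> // x [/= /eqP + /f0].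
have [//|/eqP fx0] := pselect (f x = 0).
by have : ([set x | f x != 0] `&` measure_support nu) x by []; rewrite f0.
Qed.

(** * Null functions and their integrals *)

Section NullIntegral.
Context d (T : measurableType d) (R : realType).
Variables (mu : {measure set T -> \bar R}) (f : T -> R).

Lemma Rintegral_negligible : measurable_fun setT f ->
  mu.-negligible [set x | f x != 0] -> Rintegral mu setT f = 0.
Proof.
move=> mf negf; rewrite /Rintegral (ae_eq_integral (cst 0%E)) ?integral0//.
  exact/measurable_EFinP.
apply: negligibleS negf => x /= /not_implyP[_ fx0].
by apply/eqP => fx; apply: fx0; rewrite fx.
Qed.

Lemma ge0_Rintegral_eq0 : mu.-integrable setT (EFin \o f) ->
  (forall x, 0 <= f x) -> Rintegral mu setT f = 0 ->
  mu.-negligible [set x | f x != 0].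
Proof.
move=> intf f0 If0.
have : ae_eq mu setT (EFin \o f) (cst 0%E).
  apply/ae_eq_integral_abs => //; first exact: measurable_int intf.
  under eq_integral do rewrite gee0_abs ?lee_fin//=.
  rewrite -(@fineK _ (\int[mu]_x (EFin \o f) x)%E); last first.
    exact: integrable_fin_num.
  by congr EFin.
apply: negligibleS => x /= fx0 /(_ I) [] /eqP.
by rewrite (negbTE fx0).
Qed.

End NullIntegral.

(** * The affine case *)

Section AffineEval.
Context (R : realType) (n : nat).
Implicit Types (p q : mpoly.mpoly n R).

Lemma affine_evalM p q x :
  affine_eval (p * q) x = affine_eval p x * affine_eval q x.
Proof. exact: mpoly.mevalM. Qed.

Lemma affine_evalM_neq0 p q : [set x | affine_eval (p * q) x != 0] =
  [set x | affine_eval q x != 0] `&` [set x | affine_eval p x != 0].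
Proof.
apply/funext => x; apply/propext => /=.
rewrite affine_evalM mulf_eq0 negb_or andbC.
by split=> [/andP|[? ?]]; [|apply/andP].
Qed.

Lemma affine_evalP a p q x :
  affine_eval (a *: p + q) x = a * affine_eval p x + affine_eval q x.
Proof. by rewrite /affine_eval mpoly.mevalD mpoly.mevalZ. Qed.

Lemma affine_evalE p x : affine_eval p x =
  \sum_(m <- mpoly.msupp p) mpoly.mcoeff m p * \prod_(i < n) x 0 i ^+ m i.
Proof. exact: mpoly.mevalE. Qed.

Lemma continuous_affine_eval p : continuous (affine_eval p : 'rV[R]_n -> R).
Proof.
move=> x; rewrite (_ : affine_eval p = (fun x : 'rV[R]_n =>
    \sum_(m <- mpoly.msupp p)
      mpoly.mcoeff m p * \prod_i x 0 i ^+ m i)); last first.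
  by apply/funext => y; exact: affine_evalE.
have := @continuous_sum_prod R 'rV[R]_n _ 'I_n (mpoly.msupp p)
  (fun m => mpoly.mcoeff m p) (fun m i (x : 'rV[R]_n) => x 0 i ^+ m i) x.
apply => m i.
apply: (@continuous_comp _ _ _ (fun x : 'rV[R]_n => x 0 i) (fun y => y ^+ m i)).
  exact: coord_continuous.
exact: exprn_continuous.
Qed.

Lemma integrable_affine_eval (mu : {measure set (borel 'rV[R]_n) -> \bar R}) p :
  affine_finite_moments mu -> mu.-integrable setT (EFin \o affine_eval p).
Proof.
move=> mom; rewrite (_ : _ \o _ = (fun x : 'rV[R]_n =>
    \sum_(m <- mpoly.msupp p)
      ((mpoly.mcoeff m p)%:E * (\prod_i x 0 i ^+ m i)%:E))%E); last first.
  apply/funext => x /=; rewrite affine_evalE -sumEFin.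
  by apply: eq_bigr => m _.
by apply: integrable_sum => // m _; apply: integrableZl => //; exact: mom.
Qed.

End AffineEval.

Section AffineCase.
Context (R : realType) (n : nat).
Variables (mup : {measure set (borel 'rV[R]_n) -> \bar R}).
Variables (g : mpoly.mpoly n R).
Variables (mu : {charge set (borel 'rV[R]_n) -> \bar R}).
Hypothesis mom : affine_finite_moments mup.
Hypothesis mu_density : charge_density mu mup (affine_eval g).
Implicit Types p q : mpoly.mpoly n R.

Let intE p := integrable_affine_eval p mom.

Let mE p : measurable_fun setT (affine_eval p : borel 'rV[R]_n -> R).
Proof. by apply/measurable_EFinP; exact: (measurable_int _ (intE p)). Qed.

Let mup_finite : (mup setT < +oo)%E.
Proof.
(* The total mass is the integral of the constant polynomial [1]. *)
have /integrableP[_] := intE 1.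
rewrite (eq_integral (cst 1%E)); first by rewrite integral_cst// mul1e.
by move=> x _; rewrite /= /affine_eval mpoly.meval1 normr1.
Qed.

Lemma affine_momentE p :
  affine_moment mu p = Rintegral mup setT (affine_eval (p * g)).
Proof.
have pgE : affine_eval p \* affine_eval g = affine_eval (p * g).
  by apply/funext => x; rewrite /= affine_evalM.
rewrite /affine_moment (charge_integral_density mup_finite _ mu_density)//.
- by rewrite pgE.
- by rewrite pgE; exact: intE.
Qed.

Lemma affine_moment_scalar : scalar (affine_moment mu).
Proof.
move=> a p q; rewrite !affine_momentE -RintegralZl//; last exact: intE.
rewrite -RintegralD//; last 2 first.
- by apply: (@integrableZl _ _ _ mup setT _ a (EFin \o affine_eval (p * g))).
- exact: intE.
apply: eq_Rintegral => x _.
by rewrite mulrDl -scalerAl; exact: affine_evalP.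
Qed.

Let null p := mup.-negligible [set x | affine_eval (g * p) x != 0].

Lemma vanishing_affine_support :
  vanishing (@affine_eval R n) (measure_support mu) = null.
Proof.
apply/funext => p; apply/propext; rewrite /null affine_evalM_neq0.
apply: vanishing_measure_support.
- apply: (@second_countable_rV R n rat ratr).
    exact: archimedean_inv.
  exact: ratr_dense.
- move=> U oU.
  have mU : measurable (U : set (borel 'rV[R]_n)) by exact: sub_sigma_algebra.
  rewrite -(charge_null_set (intE g) mu_density mU).
  split=> [nU A mA|nU [A mA]]; last by rewrite nU.
  by apply: contrapT => nuA; apply: nU; exists A.
- exact: continuous_affine_eval.
Qed.

Lemma affine_case (F : nat -> set (mpoly.mpoly n R)) delta d m m'
    (B : 'I_m -> mpoly.mpoly n R) (B' : 'I_m' -> mpoly.mpoly n R) :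
  filtration [set: mpoly.mpoly n R] F -> F delta g ->
  basis_of_set (F d) B -> basis_of_set (F (d + delta)%N) B' ->
  vanishing (@affine_eval R n) (measure_support mu) `&` F d
  = mxker B (moment_matrix id (affine_moment mu) B' B).
Proof.
move=> filtF Fg bB bB'; rewrite vanishing_affine_support.
apply: (null_space_kernel (phi := idfun)) filtF Fg _ _ bB bB' => //.
- exact: affine_moment_scalar.
- move=> p q np; rewrite affine_momentE; apply: Rintegral_negligible => //.
  apply: negligibleS np => x /=; apply: contraNN => /eqP gp0.
  by rewrite -mulrA [p * g]mulrC affine_evalM gp0 mulr0.
- move=> p; rewrite affine_momentE => gp0.
  have gpE x : affine_eval (g * p * p * g) x = affine_eval (g * p) x ^+ 2.
    by rewrite -mulrA [p * g]mulrC affine_evalM.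
  have gp2 x : 0 <= affine_eval (g * p * p * g) x by rewrite gpE sqr_ge0.
  have := ge0_Rintegral_eq0 (intE (g * p * p * g)) gp2 gp0.
  by apply: negligibleS => x /=; rewrite gpE sqrf_eq0.
Qed.

End AffineCase.

(** * Evaluation of Laurent polynomials *)

Section LaurentEval.
Context (C : numClosedFieldType) (n : nat).
Implicit Types (p q : laurent n C) (z : 'rV[C]_n).

Definition laurent_monomial z (a : 'rV[int]_n) : C := \prod_i z 0 i ^ a 0 i.

Lemma laurent_evalE p z : laurent_eval p z =
  monalg.mmap idfun (laurent_monomial z) p.
Proof. by []. Qed.

Lemma laurent_evalU c a z :
  laurent_eval (monalg.mkmalgU a c) z = c * laurent_monomial z a.
Proof. exact: (monalg.mmapU _ (f := idfun)). Qed.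

Lemma laurent_eval_sum (I : Type) (r : seq I) (f : I -> laurent n C) z :
  laurent_eval (\sum_(i <- r) f i) z = \sum_(i <- r) laurent_eval (f i) z.
Proof. exact: (raddf_sum (monalg.mmap idfun (laurent_monomial z))). Qed.

Lemma laurent_evalP (a : C) p q z :
  laurent_eval (a *: p + q) z = a * laurent_eval p z + laurent_eval q z.
Proof.
rewrite !laurent_evalE monalg.mmapD; congr (_ + _).
rewrite (monalg.mmapEw (monalg.msuppZ_le a p)) monalg.mmapE mulr_sumr.
by apply: eq_bigr => b _; rewrite monalg.mcoeffZ mulrA.
Qed.

Lemma laurent_monomialD z a b : (forall i, z 0 i != 0) ->
  laurent_monomial z (a + b) = laurent_monomial z a * laurent_monomial z b.
Proof.
move=> z0; rewrite -big_split; apply: eq_bigr => i _ /=.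
by rewrite mxE expfzDr.
Qed.

Lemma laurent_evalM p q z : (forall i, z 0 i != 0) ->
  laurent_eval (p * q) z = laurent_eval p z * laurent_eval q z.
Proof.
move=> z0; rewrite [p * q]/(laurent_mul p q) /laurent_mul laurent_eval_sum.
rewrite [laurent_eval p z]/laurent_eval mulr_suml; apply: eq_bigr => a _.
rewrite laurent_eval_sum mulr_sumr; apply: eq_bigr => b _.
by rewrite laurent_evalU laurent_monomialD// mulrACA.
Qed.

(** On the torus, inversion of the coordinates is complex conjugation. *)
Lemma laurent_monomialN z a : (forall i, `|z 0 i| = 1) ->
  laurent_monomial z (- a) = (laurent_monomial z a)^*.
Proof.
move=> z1; rewrite rmorph_prod; apply: eq_bigr => i _.
have z0 : z 0 i != 0 by rewrite -normr_eq0 z1 oner_eq0.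
rewrite mxE rmorphXz ?unitfE//= [X in _ = X ^ _](_ : _ = (z 0 i)^-1).
  by rewrite exprz_inv.
by rewrite invC_norm z1 expr1n invr1 mul1r.
Qed.

Lemma laurent_eval_star p z : (forall i, `|z 0 i| = 1) ->
  laurent_eval (laurent_star p) z = (laurent_eval p z)^*.
Proof.
move=> z1; rewrite /laurent_star laurent_eval_sum [in RHS]/laurent_eval.
rewrite rmorph_sum; apply: eq_bigr => a _.
by rewrite laurent_evalU laurent_monomialN// rmorphM.
Qed.

Lemma mcoeff_laurent_star p a :
  monalg.mcoeff a (laurent_star p) = (monalg.mcoeff (- a) p)^*.
Proof.
rewrite /laurent_star raddf_sum /=.
under eq_bigr do rewrite monalg.mcoeffU.
have [pa|pa] := boolP (- a \in monalg.msupp p).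
  rewrite (bigD1_seq (- a)) ?fset_uniq//= opprK eqxx big1 ?addr0// => b /negbTE ba.
  by rewrite eqr_oppLR ba.
rewrite monalg.mcoeff_outdom// rmorph0 big_seq big1// => b pb.
rewrite eqr_oppLR; case: eqP => // ba; by rewrite -ba pb in pa.
Qed.

Lemma laurent_star_semilinear (a : C) p q :
  laurent_star (a *: p + q) = a^* *: laurent_star p + laurent_star q.
Proof.
have coefP c r s b : monalg.mcoeff b (c *: r + s : laurent n C) =
    c * monalg.mcoeff b r + monalg.mcoeff b s.
  by rewrite monalg.mcoeffD monalg.mcoeffZ.
(* Abstracting the involution prevents unification from unfolding it. *)
move: (@laurent_star C n) mcoeff_laurent_star => star starE.
apply/monalg.malgP => b.
by rewrite coefP !starE coefP rmorphD rmorphM.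
Qed.

End LaurentEval.

(** * Integrals of complex-valued functions *)

Section ComplexParts.
Variable R : rcfType.
Implicit Types x y : R[i].
Local Notation Re := (@complex.Re R).
Local Notation Im := (@complex.Im R).

Lemma complex_ReD x y : Re (x + y) = Re x + Re y.
Proof. by case: x y => [? ?] [? ?]. Qed.

Lemma complex_ImD x y : Im (x + y) = Im x + Im y.
Proof. by case: x y => [? ?] [? ?]. Qed.

Lemma complex_ReM x y : Re (x * y) = Re x * Re y - Im x * Im y.
Proof. by case: x y => [? ?] [? ?]. Qed.

Lemma complex_ImM x y : Im (x * y) = Re x * Im y + Im x * Re y.
Proof. by case: x y => [? ?] [? ?]. Qed.

End ComplexParts.

Section ComplexIntegral.
Context d (T : measurableType d) (R : realType).
Variable mu : {measure set T -> \bar R}.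
Local Notation C := R[i].
Local Notation Re := (@complex.Re R).
Local Notation Im := (@complex.Im R).
Implicit Types f g h : T -> C.

Definition cintegrable f :=
  mu.-integrable setT (fun x => (Re (f x))%:E) /\
  mu.-integrable setT (fun x => (Im (f x))%:E).

Definition cintegral f : C :=
  (Rintegral mu setT (fun x => Re (f x)) +i*
   Rintegral mu setT (fun x => Im (f x)))%C.

Let integrable_lin (u v : R) (h k : T -> R) : mu.-integrable setT (EFin \o h) ->
  mu.-integrable setT (EFin \o k) ->
  mu.-integrable setT (EFin \o (fun x => u * h x + v * k x)) /\
  Rintegral mu setT (fun x => u * h x + v * k x) =
  u * Rintegral mu setT h + v * Rintegral mu setT k.
Proof.
move=> ih ik.
have iuh : mu.-integrable setT (EFin \o (fun x => u * h x)).
  exact: integrableZl ih.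
have ivk : mu.-integrable setT (EFin \o (fun x => v * k x)).
  exact: integrableZl ik.
split; first exact: (integrableD _ iuh ivk).
by rewrite RintegralD// !RintegralZl.
Qed.

Lemma cintegral_lin (a : C) f g : cintegrable f -> cintegrable g ->
  cintegrable (fun x => a * f x + g x) /\
  cintegral (fun x => a * f x + g x) = a * cintegral f + cintegral g.
Proof.
move=> [fR fI] [gR gI].
have ReE x : Re (a * f x + g x) =
    1 * (Re a * Re (f x) + (- Im a) * Im (f x)) + 1 * Re (g x).
  by rewrite complex_ReD complex_ReM !mul1r mulNr.
have ImE x : Im (a * f x + g x) =
    1 * (Re a * Im (f x) + Im a * Re (f x)) + 1 * Im (g x).
  by rewrite complex_ImD complex_ImM !mul1r.
have [i1 E1] := integrable_lin (Re a) (- Im a) fR fI.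
have [i2 E2] := integrable_lin (Re a) (Im a) fI fR.
have [i3 E3] := integrable_lin 1 1 i1 gR.
have [i4 E4] := integrable_lin 1 1 i2 gI.
split.
  split; first by under eq_fun do rewrite ReE.
  by under eq_fun do rewrite ImE.
rewrite /cintegral; under [Rintegral _ _ _]eq_Rintegral do rewrite ReE.
under [X in (_ +i* X)%C = _]eq_Rintegral do rewrite ImE.
rewrite E3 E4 E1 E2; case: a {ReE ImE i1 E1 i2 E2 i3 E3 i4 E4} => a b /=.
by simpc.
Qed.

Lemma cintegral_negligible f : cintegrable f ->
  mu.-negligible [set x | f x != 0] -> cintegral f = 0.
Proof.
move=> [/measurable_int fR /measurable_int fI] nf.
rewrite /cintegral !Rintegral_negligible//.
- exact/measurable_EFinP.
- by apply: negligibleS nf => x; apply: contraNN => /eqP ->.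
- exact/measurable_EFinP.
- by apply: negligibleS nf => x; apply: contraNN => /eqP ->.
Qed.

(** A nonnegative complex number is real, hence zero once its real part is. *)
Lemma ge0_cintegral_eq0 f : cintegrable f -> (forall x, 0 <= f x) ->
  cintegral f = 0 -> mu.-negligible [set x | f x != 0].
Proof.
move=> [fR _] f0 [If0 _].
have Ref0 x : 0 <= Re (f x) by have := f0 x; rewrite lecE => /andP[].
have := ge0_Rintegral_eq0 fR Ref0 If0; apply: negligibleS => x /=.
apply: contraNN => /eqP Rf0; have := f0 x; rewrite lecE/= => /andP[/eqP].
by case: (f x) Rf0 => u v /= -> ->.
Qed.

Lemma cintegral_sqr_eq0 f h : cintegrable f -> (forall x, f x = `|h x| ^+ 2) ->
  cintegral f = 0 -> mu.-negligible [set x | h x != 0].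
Proof.
move=> intf fE If0; have f0 x : 0 <= f x by rewrite fE exprn_ge0.
have := ge0_cintegral_eq0 intf f0 If0; apply: negligibleS => x /=.
by rewrite fE sqrf_eq0 normr_eq0.
Qed.

(** The real and imaginary parts of [f] are integrated separately against those of
the measure, so each of the four products of a part of [f] with a part of [g] has
to be integrable.  These products are half sums and half differences of the real
and imaginary parts of [f * g] and [f * g^*], whence the two assumptions. *)
Lemma cmeasure_integral_density (nu : complex_measure T R) f g :
  (mu setT < +oo)%E -> cmeasure_density nu mu g -> cintegrable f ->
  cintegrable g -> cintegrable (fun x => f x * g x) ->
  cintegrable (fun x => f x * (g x)^*) ->
  cmeasure_integral nu f = cintegral (fun x => f x * g x).
Proof.
move=> mufin [nuR nuI] [fR fI] [gR gI] [fgR fgI] [fgcR fgcI].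
have conjE (z : C) : Re z^* = Re z /\ Im z^* = - Im z by case: z.
have half (u v : R) (h k w : T -> R) : mu.-integrable setT (EFin \o h) ->
    mu.-integrable setT (EFin \o k) -> (forall x, w x = u * h x + v * k x) ->
    mu.-integrable setT (EFin \o w).
  by move=> ih ik /funext ->; have [] := integrable_lin u v ih ik.
have iRR : mu.-integrable setT (EFin \o ((Re \o f) \* (Re \o g))).
  apply: (half (1 / 2) (1 / 2) _ _ _ fgR fgcR) => x /=.
  by rewrite !complex_ReM !(conjE _).1 !(conjE _).2; field.
have iII : mu.-integrable setT (EFin \o ((Im \o f) \* (Im \o g))).
  apply: (half (- (1 / 2)) (1 / 2) _ _ _ fgR fgcR) => x /=.
  by rewrite !complex_ReM !(conjE _).1 !(conjE _).2; field.
have iRI : mu.-integrable setT (EFin \o ((Re \o f) \* (Im \o g))).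
  apply: (half (1 / 2) (- (1 / 2)) _ _ _ fgI fgcI) => x /=.
  by rewrite !complex_ImM !(conjE _).1 !(conjE _).2; field.
have iIR : mu.-integrable setT (EFin \o ((Im \o f) \* (Re \o g))).
  apply: (half (1 / 2) (1 / 2) _ _ _ fgI fgcI) => x /=.
  by rewrite !complex_ImM !(conjE _).1 !(conjE _).2; field.
have mRe : measurable_fun setT (Re \o f).
  by apply/measurable_EFinP; exact: measurable_int fR.
have mIm : measurable_fun setT (Im \o f).
  by apply/measurable_EFinP; exact: measurable_int fI.
rewrite /cmeasure_integral /cintegral.
rewrite !(charge_integral_density mufin gR nuR)//.
rewrite !(charge_integral_density mufin gI nuI)//.
rewrite -RintegralB// -RintegralD//.
congr Complex; apply: eq_Rintegral => x _ /=.
  by rewrite complex_ReM.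
by rewrite complex_ImM addrC.
Qed.

End ComplexIntegral.

(** * The trigonometric case *)

Section TorusEval.
Context (C : numClosedFieldType) (n : nat).
Local Notation T := (torus C n).
Implicit Types (p q : laurent n C) (z : T).

Lemma torus_norm z i : `|(set_val z : 'rV[C]_n) 0 i| = 1.
Proof. exact: (set_valP z). Qed.

Let torus_neq0 z i : (set_val z : 'rV[C]_n) 0 i != 0.
Proof. by rewrite -normr_eq0 torus_norm oner_eq0. Qed.

Lemma torus_evalM p q z :
  torus_eval (p * q) z = torus_eval p z * torus_eval q z.
Proof. exact: laurent_evalM (torus_neq0 z). Qed.

Lemma torus_evalM_neq0 p q : [set z | torus_eval (p * q) z != 0] =
  [set z | torus_eval q z != 0] `&` [set z | torus_eval p z != 0].
Proof.
apply/funext => z; apply/propext => /=.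
rewrite torus_evalM mulf_eq0 negb_or andbC.
by split=> [/andP|[? ?]]; [|apply/andP].
Qed.

(** This arrangement of factors is the one in which [g * p] appears in the
integrand [q° * p * g] of the moment form. *)
Lemma torus_evalMA p q r z :
  torus_eval (p * q * r) z = torus_eval p z * torus_eval (r * q) z.
Proof.
transitivity (torus_eval p z * torus_eval q z * torus_eval r z).
  by apply: etrans (torus_evalM _ _ _) _; congr (_ * _); exact: torus_evalM.
rewrite -mulrA; congr (_ * _).
by apply: etrans (mulrC _ _) _; exact: esym (torus_evalM _ _ _).
Qed.

Lemma torus_evalP a p q z :
  torus_eval (a *: p + q) z = a * torus_eval p z + torus_eval q z.
Proof. exact: laurent_evalP. Qed.

Lemma torus_eval_star p z : torus_eval (laurent_star p) z = (torus_eval p z)^*.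
Proof. exact: laurent_eval_star (torus_norm z). Qed.

Lemma torus_eval_star_sqr p q z :
  torus_eval (laurent_star (q * p) * p * q) z = `|torus_eval (q * p) z| ^+ 2.
Proof.
apply: etrans (torus_evalMA _ _ _ _) _.
apply: etrans (congr1 ( *%R^~ _) (torus_eval_star (q * p) z)) _.
by rewrite normCK mulrC.
Qed.

Lemma continuous_torus_eval p : continuous (torus_eval p : T -> C).
Proof.
move=> z.
have := @continuous_sum_prod C T _ 'I_n (monalg.msupp p)
  (fun a => monalg.mcoeff a p)
  (fun a i (z : T) => (set_val z : 'rV[C]_n) 0 i ^ a 0 i) z.
apply => a i.
apply: (@continuous_comp _ _ _ (fun z : T => (set_val z : 'rV[C]_n) 0 i)
  (fun y => y ^ a 0 i)).
  apply: (@continuous_comp _ _ _ (set_val : T -> 'rV[C]_n) (fun x => x 0 i)).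
    exact: initial_continuous.
  exact: coord_continuous.
exact/continuous_exprz/torus_neq0.
Qed.

Lemma second_countable_torus :
  @second_countable 'rV[C]_n -> @second_countable T.
Proof. exact: (@second_countable_initial (set_type _) 'rV[C]_n set_val). Qed.

End TorusEval.

Section TorusIntegral.
Context (R : realType) (n : nat).
Local Notation C := R[i].
Local Notation T := (torus C n).
Implicit Types (p q : laurent n C) (z : T).

Lemma cintegrable_torus_eval (mu : {measure set (borel T) -> \bar R}) p :
  torus_finite_moments mu -> cintegrable mu (torus_eval p).
Proof.
move=> mom; rewrite (_ : torus_eval p = (fun z : T => \sum_(a <- monalg.msupp p)
  monalg.mcoeff a p *
    \prod_(i < n) (set_val z : 'rV[C]_n) 0 i ^ a 0 i)); last by [].
(* The induction is on the list of exponents only, the coefficients staying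
those of [p]. *)
elim: {1}(monalg.msupp p : seq _) => [|a r IH].
  under eq_fun do rewrite big_nil.
  by split; exact: integrable0.
under eq_fun do rewrite big_cons.
by apply: (cintegral_lin _ _ _).1 => //; exact: mom.
Qed.

End TorusIntegral.

Section TorusCase.
Context (R : realType) (n : nat).
Local Notation C := R[i].
Local Notation T := (torus C n).
Variables (mup : {measure set (borel T) -> \bar R}) (g : laurent n C).
Variables (mu : complex_measure (borel T) R).
Hypothesis mom : torus_finite_moments mup.
Hypothesis mu_density : cmeasure_density mu mup (torus_eval g).
Implicit Types p q : laurent n C.

Let intE p := cintegrable_torus_eval p mom.

Let mup_finite : (mup setT < +oo)%E.
Proof.
(* The monomial with exponent zero is the constant [1]. *)
have [/integrableP[_] + _] := mom 0.
rewrite (eq_integral (cst 1%E)); first by rewrite integral_cst// mul1e.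
by move=> z _; rewrite big1 => [|i _]; rewrite ?mxE//= normr1.
Qed.

Lemma torus_momentE p :
  torus_moment mu p = cintegral mup (torus_eval (p * g)).
Proof.
have evalM q r : torus_eval (q * r) =
    (fun z : T => torus_eval q z * torus_eval r z).
  by apply/funext => z; rewrite torus_evalM.
rewrite /torus_moment (cmeasure_integral_density mup_finite mu_density) ?evalM//.
- by rewrite -evalM; exact: intE.
(* The conjugate of [g] is a Laurent polynomial too, so that its product with [p]
is integrable. *)
- under eq_fun do rewrite -torus_eval_star.
  by rewrite -evalM; exact: intE.
Qed.

Lemma torus_moment_scalar : scalar (torus_moment mu).
Proof.
move=> a p q; rewrite !torus_momentE.
rewrite -(cintegral_lin a (intE _) (intE _)).2; congr cintegral.
by apply/funext => z; rewrite mulrDl -scalerAl; exact: torus_evalP.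
Qed.

Let null p := mup.-negligible [set x | torus_eval (g * p) x != 0].

Lemma vanishing_torus_support :
  vanishing (@torus_eval C n) (measure_support (cmeasure_val mu)) = null.
Proof.
apply/funext => p; apply/propext; rewrite /null torus_evalM_neq0.
apply: vanishing_measure_support.
- apply: second_countable_torus.
  have := @second_countable_rV C n (rat * rat)%type
    (fun u => ratr u.1 +i* ratr u.2)%C
    (@complex_archimedean_inv R) (@complex_ratr_dense R).
  exact.
- move=> U oU.
  have mU : measurable (U : set (borel T)) by exact: sub_sigma_algebra.
  have [nuR nuI] := mu_density; have [gR gI] := intE g.
  have -> : U `&` [set x | torus_eval g x != 0] =
     (U `&` [set x | complex.Re (torus_eval g x) != 0]) `|`
     (U `&` [set x | complex.Im (torus_eval g x) != 0]).
    rewrite -setIUr; congr (_ `&` _); apply/funext => x /=.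
    by apply/propext; rewrite eq_complex negb_and; split=> [/orP|/orP].
  have nE := charge_null_set gR nuR mU.
  have nE' := charge_null_set gI nuI mU.
  split=> [nU|negU].
    have nuAU (A : set (borel T)) : measurable A -> cmeasure_val mu (A `&` U) = 0.
      by move=> mA; apply: contrapT => nuA; apply: nU; exists A.
    apply: negligibleU; [apply/nE|apply/nE'] => A mA.
      have /(congr1 (@complex.Re R)) /= re0 := nuAU A mA.
      by rewrite -[LHS]fineK ?re0// fin_num_measure//; exact: measurableI.
    have /(congr1 (@complex.Im R)) /= im0 := nuAU A mA.
    by rewrite -[LHS]fineK ?im0// fin_num_measure//; exact: measurableI.
  move=> [A mA]; apply; rewrite /cmeasure_val.
  rewrite nE.2//; last by apply: negligibleS negU; exact: subsetUl.
  by rewrite nE'.2//; apply: negligibleS negU; exact: subsetUr.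
- exact: continuous_torus_eval.
Qed.

Lemma torus_case (A : set (laurent n C)) (F : nat -> set (laurent n C))
    delta d m m' (B : 'I_m -> laurent n C) (B' : 'I_m' -> laurent n C) :
  filtration A F -> F delta g ->
  basis_of_set (F d) B -> basis_of_set (F (d + delta)%N) B' ->
  vanishing (@torus_eval C n) (measure_support (cmeasure_val mu)) `&` F d
  = mxker B (moment_matrix (@laurent_star C n) (torus_moment mu) B' B).
Proof.
move=> filtF Fg bB bB'; rewrite vanishing_torus_support.
apply: (null_space_kernel (phi := Num.conj)) filtF Fg _ _ bB bB'.
- exact: laurent_star_semilinear.
- exact: torus_moment_scalar.
- move=> p q np; rewrite torus_momentE.
  apply: cintegral_negligible; first exact: intE.
  apply: negligibleS np => x /=; apply: contraNN => /eqP gp0.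
  by rewrite torus_evalMA gp0 mulr0.
- move=> p; rewrite torus_momentE => gp0.
  exact: (cintegral_sqr_eq0 (intE _) (torus_eval_star_sqr p g) gp0).
Qed.

End TorusCase.

Theorem corollary4p12 (R : realType) (n : nat) :
  (* affine case *)
  (forall (F : nat -> set (mpoly.mpoly n R)),
     filtration [set: mpoly.mpoly n R] F ->
     (forall d, findim (F d)) ->
   forall (mup : {measure set (borel 'rV[R]_n) -> \bar R})
     (delta : nat) (g : mpoly.mpoly n R)
     (mu : {charge set (borel 'rV[R]_n) -> \bar R}),
     affine_finite_moments mup ->
     F delta g ->
     charge_density mu mup (affine_eval g) ->
   forall (d m m' : nat)
     (B : 'I_m -> mpoly.mpoly n R) (B' : 'I_m' -> mpoly.mpoly n R),
     basis_of_set (F d) B -> basis_of_set (F (d + delta)%N) B' ->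
     vanishing (@affine_eval R n) (measure_support mu) `&` F d
     = mxker B (moment_matrix id (affine_moment mu) B' B)) /\
  (* trigonometric case *)
  (forall (A : set (laurent n R[i])) (F : nat -> set (laurent n R[i])),
     A = [set: laurent n R[i]] \/ A = @is_poly n R[i] ->
     filtration A F ->
     (forall d, findim (F d)) ->
   forall (mup : {measure set (borel (torus R[i] n)) -> \bar R})
     (delta : nat) (g : laurent n R[i])
     (mu : complex_measure (borel (torus R[i] n)) R),
     torus_finite_moments mup ->
     F delta g ->
     cmeasure_density mu mup (torus_eval g) ->
   forall (d m m' : nat)
     (B : 'I_m -> laurent n R[i]) (B' : 'I_m' -> laurent n R[i]),
     basis_of_set (F d) B -> basis_of_set (F (d + delta)%N) B' ->
     vanishing (@torus_eval R[i] n) (measure_support (cmeasure_val mu)) `&` F d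
     = mxker B (moment_matrix (@laurent_star R[i] n) (torus_moment mu) B' B)).
Proof.
split=> [F filtF _ mup delta g mu mom Fg mug d m m' B B'|].
  exact: (affine_case mom mug filtF Fg).
move=> A F _ filtF _ mup delta g mu mom Fg mug d m m' B B'.
exact: (torus_case mom mug filtF Fg).
Qed.
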